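(* Let $r_1>0$, $r_2>0$, and let $v_1,v_2\neq0$, $s_1,s_2,b_1,b_2$ be real constants. Let $$g_1(x)=\sum_{n=0}^\infty\alpha_nx^n,\quad \alpha_n\sim v_1\frac{\exp(s_1n^{1/3}+r_1n^{2/3})}{n^{b_1}},\qquad g_2(x)=\sum_{n=0}^\infty\beta_nx^n,\quad \beta_n\sim v_2\frac{\exp(s_2n^{1/3}+r_2n^{2/3})}{n^{b_2}},$$ and $g(x)=g_1(x)g_2(x)=\sum_{n=0}^\infty a_nx^n$. Then $$a_n\sim\frac{3v_1v_2\sqrt\pi\,(r_1^3+r_2^3)^{b_1+b_2-\frac76}}{r_1^{3b_1-\frac32}r_2^{3b_2-\frac32}\,n^{b_1+b_2-\frac23}}\exp\!\left(\frac{(r_2^2s_1-r_1^2s_2)^2}{4r_1r_2(r_1^3+r_2^3)}+\frac{r_1s_1+r_2s_2}{(r_1^3+r_2^3)^{1/3}}n^{1/3}+(r_1^3+r_2^3)^{1/3}n^{2/3}\right).$$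
   Context: For sequences $x_n,y_n$, $x_n\sim y_n$ means $x_n/y_n\to 1$ as $n\to\infty$. *)

(* Defs.v *)
From Stdlib Require Export Reals.
From Coquelicot Require Export Coquelicot.

Open Scope R_scope.

Definition seq_equiv (x y : nat -> R) : Prop :=
  is_lim_seq (fun n => x n / y n) 1.

(* [Rpower t b = exp (b * ln t)] is the real power only for [t > 0]; the junk
   value at n = 0 does not affect limits of sequences. *)
Definition npow (n : nat) (b : R) : R := Rpower (INR n) b.

(* The domain on which a power series represents its function is left open:
   the identity is required on some neighbourhood of 0, which is what
   determines the coefficients. *)
Definition gen_fun (g : R -> R) (a : nat -> R) : Prop :=
  locally 0 (fun x => is_pseries a x (g x)).

(* Main.v *)
Require Import Defs.
From Stdlib Require Import Lra Lia.

(** Laplace's method for the Cauchy product [a_n = sum_k alpha_k beta_(n-k)].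
    Put [N = n^(1/3)], [d = (r1^3 + r2^3)^(1/3)], [eta_i = r_i / d] and
    [x = (k - eta_1^3 n) / N^2], so that [eta_1^3 + eta_2^3 = 1].  In terms of
    the cube roots of [k] and [n - k] everything is algebraic: the exponent is
    [d N^2 + (s1 eta_1 + s2 eta_2) N] plus a term that tends to a quadratic
    [B x - A x^2] for bounded [x], and that is at most [c |x| - a x^2] in the
    whole range [0 <= k <= n].  Hence the normalized sum is, up to a uniformly
    small error with respect to the weight [1 / (1 + x^2)], a Riemann sum with
    step [N^(-2)] of a Gaussian function. *)

(** The centre of the sum is where the two exponents balance. The derivative of [r_i y^2] with
    respect to [y^3] at [y = eta_i N] is [2 r_i / (3 eta_i N)], and this is [2 d / (3 N)] for both
    factors because [eta_i] is proportional to [r_i]. As the two factors have opposite deviations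
    [x] and [- x], the linear terms of order [N] cancel. Subtracting the tangents separates the
    factors: each is studied alone, as [side], and they are multiplied only at the end. The obstacle
    is the two ends of the range. Where [k] or [n - k] is small, the asymptotic hypothesis says
    nothing and a factor such as [n^b / k^b] may be unbounded. There only the boundedness of the
    ratio to the weight is used, and the power costs at most a factor [C exp (c |x|)], because [|x|]
    is at least a multiple of [N] while [ln n <= 3 N]. One Gaussian bound thus covers the whole
    range, and the true limit is needed only on windows [|x| <= M]. *)

(** * The Gaussian integral *)

Definition gauss_int (x : R) : R := RInt (fun t => exp (- t ^ 2)) 0 x.

Lemma continuous_gauss (x : R) : continuous (fun t => exp (- t ^ 2)) x.
Proof. apply (ex_derive_continuous (V := R_NormedModule)); auto_derive; exact I. Qed.

Lemma is_derive_gauss_int (x : R) : is_derive gauss_int x (exp (- x ^ 2)).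
Proof.
apply (is_derive_RInt (fun t => exp (- t ^ 2)) gauss_int 0 x).
- apply filter_forall; intros y.
  apply (RInt_correct (V := R_CompleteNormedModule) (fun t => exp (- t ^ 2))).
  apply (ex_RInt_continuous (V := R_CompleteNormedModule)); intros z _; apply continuous_gauss.
- apply continuous_gauss.
Qed.

Lemma is_derive_0_const (f : R -> R) (x y : R) :
  (forall t, is_derive f t 0) -> f x = f y.
Proof.
intros H.
destruct (MVT_gen f x y (fun _ => 0)) as [c [_ Hc]].
- intros t _; apply H.
- intros t _; apply continuity_pt_filterlim.
  apply (ex_derive_continuous (V := R_NormedModule)); exists 0; apply H.
- lra.
Qed.

Lemma gauss_int_0 : gauss_int 0 = 0.
Proof. exact (RInt_point 0 _). Qed.

Lemma gauss_int_opp (x : R) : gauss_int (- x) = - gauss_int x.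
Proof.
assert (H : forall t, is_derive (fun u => gauss_int (- u) + gauss_int u) t 0).
{ intros t; evar_last.
  - apply (is_derive_plus (V := R_NormedModule)); [|apply is_derive_gauss_int].
    apply (is_derive_comp gauss_int (fun u => - u)).
    + apply is_derive_gauss_int.
    + auto_derive; [exact I|reflexivity].
  - unfold plus, scal; simpl; unfold mult; simpl.
    replace (- t * (- t * 1)) with (t * (t * 1)) by ring; ring. }
pose proof (is_derive_0_const _ x 0 H) as E; simpl in E.
rewrite Ropp_0, gauss_int_0 in E; lra.
Qed.

(* The classical evaluation: [gauss_int x ^ 2 + RInt (gauss_kernel x) 0 1] has
   derivative 0. *)
Definition gauss_kernel (x t : R) : R := exp (- (x ^ 2 * (1 + t ^ 2))) / (1 + t ^ 2).

Lemma is_derive_gauss_kernel (x t : R) :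
  is_derive (fun u => gauss_kernel u t) x (- 2 * x * exp (- (x ^ 2 * (1 + t ^ 2)))).
Proof.
assert (0 < 1 + t ^ 2) by nra.
unfold gauss_kernel; auto_derive; [nra|].
replace (x * (x * 1)) with (x ^ 2) by ring.
replace (t * (t * 1)) with (t ^ 2) by ring.
field; lra.
Qed.

Lemma continuous_gauss_kernel (x t : R) : continuous (gauss_kernel x) t.
Proof.
apply (ex_derive_continuous (V := R_NormedModule)); unfold gauss_kernel.
auto_derive; nra.
Qed.

(** Differentiating in [x] cancels the denominator [1 + t ^ 2]; what remains splits into
    [- 2 * exp (- x ^ 2)] and [x * exp (- (x t) ^ 2)], and the substitution [u = x t] turns the
    integral of the latter into [gauss_int x]. *)
Lemma is_derive_RInt_gauss_kernel (x : R) :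
  is_derive (fun u => RInt (gauss_kernel u) 0 1) x
    (- 2 * exp (- x ^ 2) * gauss_int x).
Proof.
evar_last.
{ apply (is_derive_RInt_param gauss_kernel 0 1 x).
  - apply filter_forall; intros y t _.
    eexists; apply is_derive_gauss_kernel.
  - intros t _.
    apply continuity_2d_pt_ext with (fun u v => - 2 * u * exp (- (u ^ 2 * (1 + v ^ 2)))).
    { intros u v; symmetry; apply is_derive_unique, is_derive_gauss_kernel. }
    apply continuity_2d_pt_mult.
    { apply continuity_2d_pt_mult;
        [apply continuity_2d_pt_const | apply continuity_2d_pt_id1]. }
    apply (continuity_1d_2d_pt_comp exp).
    { apply derivable_continuous, derivable_exp. }
    apply continuity_2d_pt_opp, continuity_2d_pt_mult.
    { apply (continuity_1d_2d_pt_comp (fun z => z ^ 2)); [|apply continuity_2d_pt_id1].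
      apply derivable_continuous, derivable_pow. }
    apply continuity_2d_pt_plus; [apply continuity_2d_pt_const|].
    apply (continuity_1d_2d_pt_comp (fun z => z ^ 2)); [|apply continuity_2d_pt_id2].
    apply derivable_continuous, derivable_pow.
  - apply filter_forall; intros y; apply (ex_RInt_continuous (V := R_CompleteNormedModule)).
    intros z _; apply continuous_gauss_kernel. }
(* The [+ 0] gives the integrand the shape of an affine substitution. *)
transitivity (RInt (fun t => scal (- 2 * exp (- x ^ 2)) (scal x (exp (- (x * t + 0) ^ 2)))) 0 1).
{ apply RInt_ext; intros t _.
  etransitivity; [exact (is_derive_unique _ _ _ (is_derive_gauss_kernel x t))|].
  unfold scal; simpl; unfold mult; simpl.
  replace (- (x * (x * 1) * (1 + t * (t * 1)))) with
    (- (x * (x * 1)) + - ((x * t + 0) * ((x * t + 0) * 1))) by ring.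
  rewrite exp_plus; ring. }
assert (Ec : forall z, continuous (fun t : R => scal x (exp (- (x * t + 0) ^ 2))) z).
{ intros z; apply (ex_derive_continuous (V := R_NormedModule)).
  unfold scal; simpl; unfold mult; simpl; auto_derive; exact I. }
etransitivity.
{ apply (RInt_scal (V := R_CompleteNormedModule)
    (fun t : R => scal x (exp (- (x * t + 0) ^ 2)))).
  apply (ex_RInt_continuous (V := R_CompleteNormedModule)); intros z _; apply Ec. }
unfold scal at 1; simpl; unfold mult at 1; simpl; f_equal.
etransitivity.
{ apply (RInt_comp_lin (V := R_CompleteNormedModule) (fun t => exp (- t ^ 2)) x 0 0 1).
  apply (ex_RInt_continuous (V := R_CompleteNormedModule)).
  intros z _; apply continuous_gauss. }
unfold gauss_int; f_equal; ring.
Qed.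

Lemma gauss_int_sqr (x : R) :
  gauss_int x ^ 2 = PI / 4 - RInt (gauss_kernel x) 0 1.
Proof.
assert (H : forall t, is_derive (fun u => gauss_int u ^ 2 + RInt (gauss_kernel u) 0 1) t 0).
{ intros t; evar_last.
  - apply (is_derive_plus (V := R_NormedModule)); [|apply is_derive_RInt_gauss_kernel].
    apply is_derive_pow, is_derive_gauss_int.
  - unfold plus; simpl; ring. }
pose proof (is_derive_0_const _ x 0 H) as E; simpl in E.
rewrite gauss_int_0 in E.
(* The constant is read off at [x = 0], where the kernel is the derivative of [atan]. *)
assert (E0 : RInt (gauss_kernel 0) 0 1 = PI / 4).
{ rewrite <- atan_1; replace (atan 1) with (minus (atan 1) (atan 0)).
  2:{ rewrite atan_0; unfold minus, plus, opp; simpl; ring. }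
  apply is_RInt_unique, (is_RInt_derive (V := R_CompleteNormedModule) atan (gauss_kernel 0)).
  - intros t _; evar_last; [apply is_derive_atan|unfold gauss_kernel].
    replace (- (0 ^ 2 * (1 + t ^ 2))) with 0 by ring.
    rewrite exp_0; unfold Rsqr; field; nra.
  - intros t _; apply continuous_gauss_kernel. }
simpl; lra.
Qed.

Lemma RInt_gauss_kernel_bound (x : R) :
  0 <= RInt (gauss_kernel x) 0 1 <= exp (- x ^ 2).
Proof.
assert (I : ex_RInt (gauss_kernel x) 0 1).
{ apply (ex_RInt_continuous (V := R_CompleteNormedModule)); intros z _; apply continuous_gauss_kernel. }
split.
- apply RInt_ge_0; [lra|exact I|].
  intros t _; unfold gauss_kernel; apply Rlt_le, Rdiv_lt_0_compat; [apply exp_pos|nra].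
- replace (exp (- x ^ 2)) with (RInt (fun _ => exp (- x ^ 2)) 0 1).
  2:{ rewrite RInt_const; unfold scal; simpl; unfold mult; simpl; ring. }
  apply RInt_le; [lra|exact I|apply ex_RInt_const|].
  intros t _; unfold gauss_kernel.
  assert (Ht : 0 <= t ^ 2) by nra.
  assert (He : exp (- (x ^ 2 * (1 + t ^ 2))) <= exp (- x ^ 2)).
  { assert (Hx : 0 <= x ^ 2) by nra.
    assert (Hle : - (x ^ 2 * (1 + t ^ 2)) <= - x ^ 2) by nra.
    destruct Hle as [Hlt|Heq]; [left; now apply exp_increasing|rewrite Heq; lra]. }
  pose proof (exp_pos (- x ^ 2)).
  apply Rle_div_l; nra.
Qed.

Lemma is_lim_gauss_int : is_lim gauss_int p_infty (sqrt PI / 2).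
Proof.
replace (sqrt PI / 2) with (sqrt (PI / 4)).
2:{ rewrite sqrt_div_alt by lra.
    replace 4 with (2 * 2) by ring; rewrite sqrt_square; lra. }
apply is_lim_ext_loc with (fun x => sqrt (gauss_int x ^ 2)).
{ exists 0; intros x Hx; apply sqrt_pow2.
  apply RInt_ge_0; [lra| |intros; apply Rlt_le, exp_pos].
  apply (ex_RInt_continuous (V := R_CompleteNormedModule)); intros z _; apply continuous_gauss. }
apply (filterlim_comp _ _ _ (fun x => gauss_int x ^ 2) sqrt _ (locally (PI / 4))).
2:{ apply continuous_sqrt. }
change (is_lim (fun x => gauss_int x ^ 2) p_infty (PI / 4)).
apply is_lim_le_le_loc with (f := fun x => PI / 4 - exp (- x)) (g := fun _ => PI / 4).
- exists 1; intros x Hx.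
  rewrite gauss_int_sqr; pose proof (RInt_gauss_kernel_bound x) as [H1 H2].
  assert (exp (- x ^ 2) <= exp (- x)) by (left; apply exp_increasing; nra).
  lra.
- replace (Finite (PI / 4)) with (Finite (PI / 4 - 0)) by (f_equal; ring).
  apply is_lim_minus'; [apply is_lim_const|].
  apply is_lim_comp with m_infty.
  + apply is_lim_exp_m.
  + apply (is_lim_opp (fun y => y) p_infty p_infty), is_lim_id.
  + exists 0; intros; discriminate.
- apply is_lim_const.
Qed.

(** * Riemann sums with errors dominated by increments of the arctangent *)

(** If [|c - x| <= 1] then [c ^ 2 <= 2 * x ^ 2 + 2], hence [1 + c ^ 2 <= 3 * (1 + x ^ 2)]: this is
    the factor 3. *)
Lemma atan_step (x h : R) :
  0 < h <= 1 -> h / (1 + x ^ 2) <= 3 * (atan (x + h) - atan x).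
Proof.
intros Hh.
destruct (MVT_cor2 atan (fun t => / (1 + t ^ 2)) x (x + h)) as [c [Ec Hc]].
- lra.
- intros c _; apply derivable_pt_lim_atan.
- rewrite Ec.
  assert (Hx : 0 < 1 + x ^ 2) by nra.
  assert (Hcp : 0 < 1 + c ^ 2) by nra.
  assert (Hle : / (1 + x ^ 2) <= 3 * / (1 + c ^ 2)).
  { apply (Rmult_le_reg_r ((1 + x ^ 2) * (1 + c ^ 2))); [nra|].
    replace (/ (1 + x ^ 2) * ((1 + x ^ 2) * (1 + c ^ 2))) with (1 + c ^ 2) by (field; lra).
    replace (3 * / (1 + c ^ 2) * ((1 + x ^ 2) * (1 + c ^ 2))) with (3 * (1 + x ^ 2))
      by (field; lra).
    assert ((c - x) ^ 2 <= 1) by nra.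
    nra. }
  replace (3 * (/ (1 + c ^ 2) * (x + h - x))) with (3 * / (1 + c ^ 2) * h) by ring.
  unfold Rdiv; rewrite Rmult_comm; apply Rmult_le_compat_r; lra.
Qed.

(** The mean value theorem, applied to [Psi] and then to [f], gives the error of one rectangle. The
    3 again compares the weights at two points at distance at most 1. *)
Lemma primitive_step (Psi f f' : R -> R) (C x h : R) :
  (forall t, is_derive Psi t (f t)) -> (forall t, is_derive f t (f' t)) ->
  (forall t, Rabs (f' t) <= C / (1 + t ^ 2)) -> 0 < h <= 1 ->
  Rabs (Psi (x + h) - Psi x - h * f x) <= h * (3 * C * h / (1 + x ^ 2)).
Proof.
intros HP Hf HC Hh.
destruct (MVT_cor2 Psi f x (x + h)) as [c [Ec Hc]].
{ lra. } { intros c _; apply is_derive_Reals, HP. }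
destruct (MVT_cor2 f f' x c) as [d [Ed Hd]].
{ lra. } { intros d _; apply is_derive_Reals, Hf. }
replace (Psi (x + h) - Psi x - h * f x) with (h * (f' d * (c - x))).
2:{ rewrite Ec, <- Ed; ring. }
rewrite Rabs_mult, (Rabs_pos_eq h) by lra.
apply Rmult_le_compat_l; [lra|].
rewrite Rabs_mult, (Rabs_pos_eq (c - x)) by lra.
assert (HC0 : 0 <= C).
{ pose proof (HC 0) as H0; pose proof (Rabs_pos (f' 0)).
  replace (1 + 0 ^ 2) with 1 in H0 by ring; lra. }
assert (Hx : 0 < 1 + x ^ 2) by nra.
assert (Hdp : 0 < 1 + d ^ 2) by nra.
apply Rle_trans with (C / (1 + d ^ 2) * h).
{ apply Rmult_le_compat; [apply Rabs_pos|lra|apply HC|lra]. }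
replace (3 * C * h / (1 + x ^ 2)) with (3 * C / (1 + x ^ 2) * h) by (field; lra).
apply Rmult_le_compat_r; [lra|].
apply Rle_div_l; [lra|].
replace (3 * C / (1 + x ^ 2) * (1 + d ^ 2)) with (C * (3 * (1 + d ^ 2)) / (1 + x ^ 2))
  by (field; lra).
apply Rle_div_r; [lra|].
apply Rmult_le_compat_l; [lra|].
assert ((d - x) ^ 2 <= 1) by nra.
nra.
Qed.

Lemma sum_telescope_bound (Psi : R -> R) (q : nat -> R) (X h delta : R) (n : nat) :
  (forall k, (k <= n)%nat ->
     Rabs (h * q k - (Psi (X + INR k * h + h) - Psi (X + INR k * h)))
     <= delta * (atan (X + INR k * h + h) - atan (X + INR k * h))) ->
  Rabs (h * sum_f_R0 q n - (Psi (X + INR n * h + h) - Psi X))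
    <= delta * (atan (X + INR n * h + h) - atan X).
Proof.
induction n as [|n IH]; intros H.
- specialize (H 0%nat (Nat.le_refl _)); simpl in *.
  rewrite Rmult_0_l, Rplus_0_r in *; exact H.
- assert (IH' := IH (fun k Hk => H k (Nat.le_trans _ _ _ Hk (Nat.le_succ_diag_r n)))).
  specialize (H (S n) (Nat.le_refl _)).
  replace (X + INR (S n) * h) with (X + INR n * h + h) in * by (rewrite S_INR; ring).
  rewrite tech5.
  eapply Rle_trans; [|eapply Rle_trans; [apply (Rplus_le_compat _ _ _ _ IH' H)|right; ring]].
  eapply Rle_trans; [|apply Rabs_triang].
  right; f_equal; ring.
Qed.

(* The weight [1 / (1 + x ^ 2)] makes the pointwise errors summable: by
   [atan_step] they are dominated by the increments of [3 * atan]. *)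
Lemma is_lim_seq_riemann (Psi f f' : R -> R) (C Lm Lp : R)
    (Q : nat -> nat -> R) (X h : nat -> R) :
  (forall t, is_derive Psi t (f t)) -> (forall t, is_derive f t (f' t)) ->
  (forall t, Rabs (f' t) <= C / (1 + t ^ 2)) ->
  is_lim Psi m_infty Lm -> is_lim Psi p_infty Lp ->
  eventually (fun n => 0 < h n) -> is_lim_seq h 0 ->
  is_lim_seq X m_infty -> is_lim_seq (fun n => X n + INR n * h n + h n) p_infty ->
  (forall eps, 0 < eps -> eventually (fun n => forall k, (k <= n)%nat ->
     Rabs (Q n k - f (X n + INR k * h n)) <= eps / (1 + (X n + INR k * h n) ^ 2))) ->
  is_lim_seq (fun n => h n * sum_f_R0 (Q n) n) (Lp - Lm).
Proof.
intros HP Hf HC HLm HLp Hh Hh0 HXm HXp HQ.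
set (D := fun n => Psi (X n + INR n * h n + h n) - Psi (X n)).
assert (HD : is_lim_seq D (Lp - Lm)).
{ apply is_lim_seq_minus'.
  - exact (filterlim_comp _ _ _ _ Psi _ _ _ HXp HLp).
  - exact (filterlim_comp _ _ _ _ Psi _ _ _ HXm HLm). }
apply is_lim_seq_ext with (fun n => (h n * sum_f_R0 (Q n) n - D n) + D n).
{ intros n; ring. }
replace (Finite (Lp - Lm)) with (Finite (0 + (Lp - Lm))) by (f_equal; ring).
apply is_lim_seq_plus'; [|exact HD].
assert (HC0 : 0 <= C).
{ pose proof (HC 0) as H0; pose proof (Rabs_pos (f' 0)).
  replace (1 + 0 ^ 2) with 1 in H0 by ring; lra. }
apply is_lim_seq_spec; intros eps.
pose proof PI_RGT_0 as HPI; pose proof (cond_pos eps) as Heps.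
(* Each term errs by at most [2 * e * h / (1 + x ^ 2)], half of it from the rectangle and half from
   [Q], hence by [6 * e] times an increment of [atan]. The total increment is below [PI], so the sum
   stays below [6 * e * PI = eps / 2]. *)
set (e := eps / (12 * PI)).
assert (He : 0 < e) by (apply Rdiv_lt_0_compat; lra).
set (e' := Rmin 1 (e / (3 * C + 1))).
assert (He' : 0 < e').
{ apply Rmin_glb_lt; [lra|apply Rdiv_lt_0_compat; lra]. }
apply is_lim_seq_spec in Hh0.
generalize (filter_and _ _ (filter_and _ _ Hh (Hh0 (mkposreal _ He'))) (HQ e He)).
apply filter_imp; intros n [[Hhp Hhs] Hq]; simpl in Hhs.
rewrite Rminus_0_r, Rabs_pos_eq in Hhs by lra.
assert (H1 : h n <= 1) by (unfold e' in Hhs; pose proof (Rmin_l 1 (e / (3 * C + 1))); lra).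
assert (H2 : 3 * C * h n <= e).
{ assert (Hb : h n <= e / (3 * C + 1))
    by (unfold e' in Hhs; pose proof (Rmin_r 1 (e / (3 * C + 1))); lra).
  apply Rle_div_r in Hb; nra. }
rewrite Rminus_0_r.
eapply Rle_lt_trans.
{ apply (sum_telescope_bound Psi (Q n) (X n) (h n) (6 * e)).
  intros k Hk; specialize (Hq k Hk); set (x := X n + INR k * h n) in *.
  assert (Hx : 0 < 1 + x ^ 2) by nra.
  apply Rle_trans with (2 * e * (h n / (1 + x ^ 2))).
  2:{ pose proof (atan_step x (h n) (conj Hhp H1)); nra. }
  replace (h n * Q n k - (Psi (x + h n) - Psi x)) with
    (h n * (Q n k - f x) + - (Psi (x + h n) - Psi x - h n * f x)) by ring.
  eapply Rle_trans; [apply Rabs_triang|].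
  rewrite Rabs_Ropp, Rabs_mult, (Rabs_pos_eq (h n)) by lra.
  pose proof (primitive_step Psi f f' C x (h n) HP Hf HC (conj Hhp H1)) as Hs.
  assert (3 * C * h n / (1 + x ^ 2) <= e / (1 + x ^ 2)).
  { apply Rmult_le_compat_r; [apply Rlt_le, Rinv_0_lt_compat; lra|exact H2]. }
  replace (2 * e * (h n / (1 + x ^ 2))) with (h n * (e / (1 + x ^ 2)) + h n * (e / (1 + x ^ 2)))
    by (field; lra).
  apply Rplus_le_compat; [|eapply Rle_trans; [exact Hs|]]; apply Rmult_le_compat_l; lra. }
pose proof (atan_bound (X n + INR n * h n + h n)); pose proof (atan_bound (X n)).
apply Rlt_le_trans with (6 * e * PI * 2); [|right; unfold e; field; lra].
assert (atan (X n + INR n * h n + h n) - atan (X n) < PI) by lra.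
nra.
Qed.

(** * Cube roots of natural numbers *)

(* [npow 0 (1/3)] is the junk value 1, whereas [cbrt n ^ 3 = n] must hold also
   at [n = 0]. *)
Definition cbrt (n : nat) : R :=
  match n with O => 0 | S _ => npow n (1/3) end.

Lemma npow_pos (n : nat) (b : R) : 0 < npow n b.
Proof. apply exp_pos. Qed.

Lemma cbrt_ge_0 (n : nat) : 0 <= cbrt n.
Proof. destruct n; simpl; [lra|apply Rlt_le, npow_pos]. Qed.

Lemma cbrt_npow (n : nat) : (1 <= n)%nat -> cbrt n = npow n (1/3).
Proof. destruct n; [lia|reflexivity]. Qed.

Lemma cbrt_pos (n : nat) : (1 <= n)%nat -> 0 < cbrt n.
Proof. intros Hn; rewrite cbrt_npow by exact Hn; apply npow_pos. Qed.

Lemma cbrt_sqr_npow (n : nat) : (1 <= n)%nat -> cbrt n ^ 2 = npow n (2/3).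
Proof.
intros Hn; rewrite cbrt_npow by exact Hn; simpl; rewrite Rmult_1_r.
unfold npow; rewrite <- Rpower_plus; f_equal; field.
Qed.

Lemma cbrt_pow3 (n : nat) : cbrt n ^ 3 = INR n.
Proof.
destruct n as [|n]; [simpl; ring|].
assert (Hn : 0 < INR (S n)) by (apply lt_0_INR; lia).
rewrite cbrt_npow by lia; simpl; rewrite Rmult_1_r.
unfold npow; rewrite <- !Rpower_plus.
replace (1 / 3 + (1 / 3 + 1 / 3)) with 1 by field.
apply Rpower_1, Hn.
Qed.

Lemma cube_le (x y : R) : 0 <= x -> 0 <= y -> x ^ 3 <= y ^ 3 -> x <= y.
Proof.
intros Hx Hy H; destruct (Rle_or_lt x y) as [Hxy|Hxy]; [exact Hxy|exfalso].
assert (0 < x) by lra; assert (0 <= y * y) by nra; assert (0 < x * x) by nra.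
assert (y * y < x * x) by nra.
nra.
Qed.

Lemma cbrt_le (m n : nat) : (m <= n)%nat -> cbrt m <= cbrt n.
Proof.
intros H; apply cube_le; try apply cbrt_ge_0.
rewrite !cbrt_pow3; apply le_INR, H.
Qed.

Lemma is_lim_seq_cbrt : is_lim_seq cbrt p_infty.
Proof.
apply is_lim_seq_spec; intros M.
pose proof is_lim_seq_INR as HI; apply is_lim_seq_spec in HI.
generalize (HI (Rabs M ^ 3)); apply filter_imp; intros n Hn.
apply Rnot_le_lt; intros H.
assert (cbrt n <= Rabs M) by (pose proof (Rle_abs M); lra).
pose proof (cbrt_ge_0 n).
assert (cbrt n ^ 3 <= Rabs M ^ 3) by (apply pow_incr; lra).
rewrite cbrt_pow3 in *; lra.
Qed.

(** * The normalized factors and their domination on the whole range *)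

(** The second derivative of [t^(2/3)] at [t] of order [n] has order [n^(-4/3)], so deviations of
    order [n^(2/3)] are those that change the exponent by a bounded amount. *)
Definition dev (eta : R) (n m : nat) : R :=
  (INR m - eta ^ 3 * INR n) / cbrt n ^ 2.

(** As [ln 0] is 0, the denominator is 1 at [n = 0]; the weight is positive at every index, and
    ratios to it make sense from 0 on. *)
Definition weight (r s b : R) (n : nat) : R :=
  exp (s * cbrt n + r * cbrt n ^ 2) / npow n b.

(* One factor of the [n]-th term, normalized by the tangent of its exponent at
   [m = eta^3 n]; the terms [2/3 d N x] of the two factors cancel. *)
Definition side (d eta s b : R) (al : nat -> R) (n m : nat) : R :=
  al m * npow n b * exp (- (d * eta * (eta * cbrt n) ^ 2 + s * (eta * cbrt n)
                            + 2 / 3 * d * cbrt n * dev eta n m)).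

Lemma weight_pos (r s b : R) (n : nat) : 0 < weight r s b n.
Proof. apply Rdiv_lt_0_compat; [apply exp_pos|apply npow_pos]. Qed.

Lemma dev_cbrt (eta : R) (n m : nat) : (1 <= n)%nat ->
  dev eta n m * cbrt n ^ 2 = cbrt m ^ 3 - (eta * cbrt n) ^ 3.
Proof.
intros Hn; pose proof (cbrt_pos n Hn) as HN.
unfold dev; rewrite <- !cbrt_pow3; field; lra.
Qed.

(* The excess of [r y^2] over its tangent (as a function of [y^3]) at
   [y0 = eta N] is exactly [- d (y - y0)^2 (2 y + y0) / (3 N)] when
   [r = d eta]. *)
Lemma side_eq (d eta s b : R) (al : nat -> R) (n m : nat) : (1 <= n)%nat ->
  side d eta s b al n m =
  al m / weight (d * eta) s b m * (npow n b / npow m b)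
  * exp (s * (cbrt m - eta * cbrt n)
         - d / (3 * cbrt n) * ((cbrt m - eta * cbrt n) ^ 2 * (2 * cbrt m + eta * cbrt n))).
Proof.
intros Hn; pose proof (cbrt_pos n Hn) as HN.
pose proof (dev_cbrt eta n m Hn) as Hx.
pose proof (npow_pos m b).
unfold side, weight.
assert (Hx' : dev eta n m = (cbrt m ^ 3 - (eta * cbrt n) ^ 3) / cbrt n ^ 2).
{ rewrite <- Hx; field; lra. }
rewrite Hx'; set (y := cbrt m) in *; set (N := cbrt n) in *.
replace (s * (y - eta * N) - d / (3 * N) * ((y - eta * N) ^ 2 * (2 * y + eta * N))) with
  ((s * y + d * eta * y ^ 2) + - (d * eta * (eta * N) ^ 2 + s * (eta * N) +
      2 / 3 * d * N * ((y ^ 3 - (eta * N) ^ 3) / N ^ 2))) by (field; lra).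
rewrite (exp_plus (s * y + _)).
pose proof (exp_pos (s * y + d * eta * y ^ 2)).
field; lra.
Qed.

(** Factorization of a difference of cubes. The denominator depends only on the ratio of the cube
    roots; it is at least [eta ^ 2], and at most 3 when [m <= n] and [eta <= 1], which gives the two
    estimates below. *)
Lemma cbrt_dev_eq (eta : R) (n m : nat) : 0 < eta -> (1 <= n)%nat ->
  cbrt m - eta * cbrt n =
  dev eta n m / ((cbrt m / cbrt n) ^ 2 + cbrt m / cbrt n * eta + eta ^ 2).
Proof.
intros He Hn; pose proof (cbrt_pos n Hn) as HN; pose proof (cbrt_ge_0 m) as Hy.
assert (Hx' : dev eta n m = (cbrt m ^ 3 - (eta * cbrt n) ^ 3) / cbrt n ^ 2).
{ rewrite <- (dev_cbrt eta n m Hn); field; lra. }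
rewrite Hx'; field.
split; [lra|]; assert (0 < eta * cbrt n) by nra; nra.
Qed.

Lemma cbrt_dev_le (eta : R) (n m : nat) : 0 < eta -> (1 <= n)%nat ->
  Rabs (cbrt m - eta * cbrt n) <= Rabs (dev eta n m) / eta ^ 2.
Proof.
intros He Hn; rewrite (cbrt_dev_eq eta n m He Hn).
assert (Hu : 0 <= cbrt m / cbrt n).
{ apply Rdiv_le_0_compat; [apply cbrt_ge_0|apply cbrt_pos, Hn]. }
set (u := cbrt m / cbrt n) in *.
assert (0 < eta ^ 2) by nra; assert (0 <= u * eta) by nra.
rewrite Rabs_div by nra; rewrite (Rabs_pos_eq (u ^ 2 + _ + _)) by nra.
apply Rmult_le_compat_l; [apply Rabs_pos|].
apply Rinv_le_contravar; nra.
Qed.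

Lemma cbrt_dev_ge (eta : R) (n m : nat) : 0 < eta <= 1 -> (1 <= n)%nat -> (m <= n)%nat ->
  Rabs (dev eta n m) / 3 <= Rabs (cbrt m - eta * cbrt n).
Proof.
intros He Hn Hm; rewrite (cbrt_dev_eq eta n m (proj1 He) Hn).
pose proof (cbrt_pos n Hn) as HN.
assert (Hu : 0 <= cbrt m / cbrt n <= 1).
{ split; [apply Rdiv_le_0_compat; [apply cbrt_ge_0|exact HN]|].
  apply Rle_div_l; [exact HN|]; rewrite Rmult_1_l; apply cbrt_le, Hm. }
set (u := cbrt m / cbrt n) in *.
assert (0 < eta ^ 2) by nra; assert (0 <= u * eta) by nra.
rewrite Rabs_div by nra; rewrite (Rabs_pos_eq (u ^ 2 + _ + _)) by nra.
apply Rmult_le_compat_l; [apply Rabs_pos|].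
apply Rinv_le_contravar; nra.
Qed.

Lemma npow_ratio (n m : nat) (b : R) :
  npow n b / npow m b = exp (b * (ln (INR n) - ln (INR m))).
Proof.
unfold npow, Rpower, Rdiv; rewrite <- exp_Ropp, <- exp_plus; f_equal; ring.
Qed.

Lemma exp_le (x y : R) : x <= y -> exp x <= exp y.
Proof. intros [H| ->]; [left; now apply exp_increasing|right; reflexivity]. Qed.

Lemma ln_INR_0 : ln (INR 0) = 0.
Proof.
simpl; unfold ln; destruct (Rlt_dec 0 0) as [H|H]; [|reflexivity].
exfalso; exact (Rlt_irrefl _ H).
Qed.

Lemma ln_INR_ge_0 (n : nat) : 0 <= ln (INR n).
Proof.
destruct n as [|n].
- rewrite ln_INR_0; apply Rle_refl.
- rewrite <- ln_1; apply ln_le; [lra|].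
  rewrite S_INR; pose proof (pos_INR n); lra.
Qed.

Lemma ln_INR_le (m n : nat) : (m <= n)%nat -> ln (INR m) <= ln (INR n).
Proof.
destruct m as [|m]; intros H.
- rewrite ln_INR_0; apply ln_INR_ge_0.
- apply ln_le; [apply lt_0_INR; lia|apply le_INR, H].
Qed.

Lemma ln_le_self (x : R) : 0 < x -> ln x <= x.
Proof.
intros Hx; pose proof (exp_ineq1_le (ln x)) as H; rewrite exp_ln in H by exact Hx; lra.
Qed.

(** For [m >= eta^3 n / 2] the quotient [n / m] is at most [2 / eta^3]. Otherwise
    [|x| >= eta^3 N / 2], and the crude [ln n = 3 ln N <= 3 N] is already linear in [|x|]; with
    [ln 0 = 0] this includes [m = 0]. *)
Lemma ln_ratio_bound (eta : R) (n m : nat) : 0 < eta -> (1 <= n)%nat -> (m <= n)%nat ->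
  Rabs (ln (INR n) - ln (INR m))
    <= Rabs (ln (2 / eta ^ 3)) + 6 / eta ^ 3 * Rabs (dev eta n m).
Proof.
intros He Hn Hm; pose proof (cbrt_pos n Hn) as HN.
pose proof (ln_INR_le m n Hm) as Hln.
rewrite Rabs_pos_eq by lra.
assert (Hn0 : 0 < INR n) by (apply lt_0_INR; lia).
assert (He3 : 0 < eta ^ 3) by (apply pow_lt, He).
destruct (Rle_or_lt (eta ^ 3 * INR n / 2) (INR m)) as [Hbig|Hsmall].
- assert (H0 : 0 < eta ^ 3 * INR n / 2) by nra.
  assert (H1 : ln (INR n) - ln (INR m) <= ln (2 / eta ^ 3)).
  { assert (ln (INR n) <= ln (2 / eta ^ 3) + ln (INR m)); [|lra].
    rewrite <- ln_mult; [|apply Rdiv_lt_0_compat; lra|lra].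
    apply ln_le; [exact Hn0|].
    replace (INR n) with (2 / eta ^ 3 * (eta ^ 3 * INR n / 2)) by (field; lra).
    apply Rmult_le_compat_l; [apply Rlt_le, Rdiv_lt_0_compat; lra|exact Hbig]. }
  pose proof (Rle_abs (ln (2 / eta ^ 3))); pose proof (Rabs_pos (dev eta n m)).
  assert (0 < 6 / eta ^ 3) by (apply Rdiv_lt_0_compat; lra).
  nra.
- assert (H1 : eta ^ 3 * cbrt n / 2 <= Rabs (dev eta n m)).
  { rewrite <- Rabs_Ropp; eapply Rle_trans; [|apply Rle_abs].
    unfold dev; rewrite <- Rdiv_opp_l; apply (Rle_div_r (eta ^ 3 * cbrt n / 2)); [nra|].
    replace (eta ^ 3 * cbrt n / 2 * cbrt n ^ 2) with (eta ^ 3 * cbrt n ^ 3 / 2) by field.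
    rewrite cbrt_pow3; lra. }
  assert (H2 : ln (INR n) <= 3 * cbrt n).
  { rewrite <- cbrt_pow3, ln_pow by exact HN.
    replace (INR 3) with 3 by (simpl; ring).
    apply Rmult_le_compat_l; [lra|apply ln_le_self, HN]. }
  assert (H3 : 3 * cbrt n <= 6 / eta ^ 3 * Rabs (dev eta n m)).
  { replace (3 * cbrt n) with (6 / eta ^ 3 * (eta ^ 3 * cbrt n / 2)) by (field; lra).
    apply Rmult_le_compat_l; [apply Rlt_le, Rdiv_lt_0_compat; lra|exact H1]. }
  pose proof (ln_INR_ge_0 m); pose proof (Rabs_pos (ln (2 / eta ^ 3))); lra.
Qed.

Lemma side_bound (d eta s b v : R) (al : nat -> R) :
  0 < d -> 0 < eta <= 1 -> is_lim_seq (fun m => al m / weight (d * eta) s b m) v ->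
  exists C c, 0 <= C /\ forall n m, (1 <= n)%nat -> (m <= n)%nat ->
    Rabs (side d eta s b al n m)
      <= C * exp (c * Rabs (dev eta n m) - d * eta / 27 * dev eta n m ^ 2).
Proof.
intros Hd He Hal.
(* A convergent sequence is bounded from index 0 on; for small [m] this is all that is known about
   [al m]. *)
destruct (filterlim_bounded (V := R_NormedModule) (fun m => al m / weight (d * eta) s b m)) as [C HC].
{ exists v; exact Hal. }
set (K := Rabs (ln (2 / eta ^ 3))); set (k := 6 / eta ^ 3).
exists (C * exp (Rabs b * K)), (Rabs b * k + Rabs s / eta ^ 2).
assert (HC0 : 0 <= C).
{ eapply Rle_trans; [|apply (HC 0%nat)]; apply norm_ge_0. }
split; [apply Rmult_le_pos; [exact HC0|apply Rlt_le, exp_pos]|].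
intros n m Hn Hm; pose proof (cbrt_pos n Hn) as HN.
rewrite side_eq by exact Hn.
rewrite npow_ratio, !Rabs_mult.
rewrite !(Rabs_pos_eq (exp _)) by apply Rlt_le, exp_pos.
rewrite !Rmult_assoc; apply Rmult_le_compat; [apply Rabs_pos| |apply HC|].
{ apply Rlt_le, Rmult_lt_0_compat; apply exp_pos. }
rewrite <- !exp_plus; apply exp_le.
pose proof (ln_ratio_bound eta n m (proj1 He) Hn Hm) as H1.
pose proof (cbrt_dev_le eta n m (proj1 He) Hn) as H2.
pose proof (cbrt_dev_ge eta n m He Hn Hm) as H3.
fold K k in H1; set (x := dev eta n m) in *.
set (l := ln (INR n) - ln (INR m)) in *; set (e := cbrt m - eta * cbrt n) in *.
assert (H4 : b * l <= Rabs b * (K + k * Rabs x)).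
{ eapply Rle_trans; [apply Rle_abs|]; rewrite Rabs_mult.
  apply Rmult_le_compat_l; [apply Rabs_pos|exact H1]. }
assert (H5 : s * e <= Rabs s * (Rabs x / eta ^ 2)).
{ eapply Rle_trans; [apply Rle_abs|]; rewrite Rabs_mult.
  apply Rmult_le_compat_l; [apply Rabs_pos|exact H2]. }
assert (H6 : x ^ 2 / 9 <= e ^ 2).
{ rewrite <- (pow2_abs x), <- (pow2_abs e).
  pose proof (Rabs_pos x); nra. }
(* The 27 is [3 * 9]: the 9 comes from squaring the lower bound [|x| / 3] for [|e|], the 3 from
   [d / (3 * cbrt n)]; the term [2 * cbrt m >= 0] is dropped. *)
assert (H7 : d * eta / 27 * x ^ 2 <= d / (3 * cbrt n) * (e ^ 2 * (2 * cbrt m + eta * cbrt n))).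
{ apply Rle_trans with (d / (3 * cbrt n) * (x ^ 2 / 9 * (eta * cbrt n))).
  { right; field; lra. }
  pose proof (cbrt_ge_0 m); assert (0 < eta * cbrt n) by nra.
  apply Rmult_le_compat_l; [apply Rlt_le, Rdiv_lt_0_compat; lra|].
  apply Rmult_le_compat; nra. }
unfold Rdiv in *; nra.
Qed.

(** * Uniform limits on windows of bounded deviation *)

(* Limits as [n -> oo], uniformly in [m <= n] with [|X n m| <= M]. *)
Definition window (X : nat -> nat -> R) (M : R) (P : nat * nat -> Prop) : Prop :=
  eventually (fun n => forall m, (m <= n)%nat -> Rabs (X n m) <= M -> P (n, m)).

(** Only a [Filter], not a [ProperFilter]: for negative [M] the window is empty. *)
Global Instance window_filter (X : nat -> nat -> R) (M : R) : Filter (window X M).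
Proof.
split; unfold window.
- apply filter_forall; intros; exact I.
- intros P Q HP HQ; generalize (filter_and _ _ HP HQ); apply filter_imp.
  intros n [H1 H2] m Hm HM; split; auto.
- intros P Q HPQ; apply filter_imp; intros n H m Hm HM; auto.
Qed.

Lemma filterlim_Rmult {T : Type} (F : (T -> Prop) -> Prop) {FF : Filter F}
    (f g : T -> R) (a b : R) :
  filterlim f F (locally a) -> filterlim g F (locally b) ->
  filterlim (fun x => f x * g x) F (locally (a * b)).
Proof.
intros Hf Hg.
exact (filterlim_comp_2 _ _ _ Hf Hg (filterlim_mult (K := R_AbsRing) a b)).
Qed.

(** In a window the deviation is bounded but has no limit, so the product rule for limits does not
    apply to it. *)
Lemma filterlim_bounded_mult_0 {T : Type} (F : (T -> Prop) -> Prop) {FF : Filter F}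
    (f g : T -> R) (K : R) :
  F (fun x => Rabs (f x) <= K) -> filterlim g F (locally 0) ->
  filterlim (fun x => f x * g x) F (locally 0).
Proof.
intros Hf Hg; apply filterlim_locally; intros eps.
assert (HK : 0 < Rabs K + 1) by (pose proof (Rabs_pos K); lra).
assert (He : 0 < eps / (Rabs K + 1)) by (apply Rdiv_lt_0_compat; [apply cond_pos|exact HK]).
generalize (filter_and _ _ Hf (proj1 (filterlim_locally _ _) Hg (mkposreal _ He))).
apply filter_imp; intros x [H1 H2].
change (Rabs (f x * g x - 0) < eps); change (Rabs (g x - 0) < eps / (Rabs K + 1)) in H2.
rewrite Rminus_0_r in *; rewrite Rabs_mult.
apply Rlt_div_r in H2; [|exact HK].
pose proof (Rle_abs K); pose proof (Rabs_pos (g x)); nra.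
Qed.

Lemma window_eventually (X : nat -> nat -> R) (M : R) (P : nat -> Prop) :
  eventually P -> window X M (fun p => P (fst p)).
Proof. unfold window; apply filter_imp; intros n H m _ _; exact H. Qed.

Lemma window_le (X : nat -> nat -> R) (M : R) :
  window X M (fun p => (snd p <= fst p)%nat).
Proof. unfold window; apply filter_forall; intros n m H _; exact H. Qed.

Lemma window_bound (X : nat -> nat -> R) (M : R) :
  window X M (fun p => Rabs (X (fst p) (snd p)) <= M).
Proof. unfold window; apply filter_forall; intros n m _ H; exact H. Qed.

Lemma eventually_ge (k : nat) : eventually (fun n => (k <= n)%nat).
Proof. exists k; auto. Qed.

Lemma eventually_cbrt_gt (M : R) : eventually (fun n => M < cbrt n).
Proof. pose proof is_lim_seq_cbrt as H; apply is_lim_seq_spec in H; exact (H M). Qed.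

Lemma window_cbrt_ratio (eta M : R) : 0 < eta ->
  filterlim (fun p => cbrt (snd p) / cbrt (fst p)) (window (dev eta) M) (locally eta).
Proof.
intros He; apply filterlim_locally; intros eps.
generalize (filter_and _ _ (window_bound (dev eta) M)
  (window_eventually (dev eta) M _
    (filter_and _ _ (eventually_ge 1) (eventually_cbrt_gt (M / eta ^ 2 / eps))))).
apply filter_imp; intros [n m] [HM [Hn HN]]; simpl fst in *; simpl snd in *.
change (Rabs (cbrt m / cbrt n - eta) < eps).
pose proof (cbrt_pos n Hn) as HNp; pose proof (cond_pos eps) as Heps.
replace (cbrt m / cbrt n - eta) with ((cbrt m - eta * cbrt n) / cbrt n) by (field; lra).
rewrite Rabs_div, (Rabs_pos_eq (cbrt n)) by lra.
apply (Rlt_div_l (Rabs (cbrt m - eta * cbrt n))); [exact HNp|].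
apply (Rlt_div_l (M / eta ^ 2)) in HN; [|exact Heps].
eapply Rle_lt_trans; [apply (cbrt_dev_le eta n m He Hn)|].
apply Rle_lt_trans with (M / eta ^ 2); [|lra].
apply Rmult_le_compat_r; [apply Rlt_le, Rinv_0_lt_compat; nra|exact HM].
Qed.

(** In a window [cbrt m] stays within [M / eta ^ 2] of [eta * cbrt n], so the asymptotics of [al m]
    are available throughout it. *)
Lemma window_snd (eta M : R) : 0 < eta ->
  filterlim (snd : nat * nat -> nat) (window (dev eta) M) eventually.
Proof.
intros He P [k Hk].
(* With this bound [cbrt m >= k + 1] even after the largest deviation; the [+ 1] ensures
   [cbrt m >= 1], whence [cbrt m ^ 3 >= cbrt m]. *)
unfold filtermap; set (B := (INR k + 1 + M / eta ^ 2) / eta).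
generalize (filter_and _ _ (window_bound (dev eta) M)
  (window_eventually (dev eta) M _
    (filter_and _ _ (eventually_ge 1) (eventually_cbrt_gt B)))).
apply filter_imp; intros [n m] [HM [Hn HN]]; simpl fst in *; simpl snd in *.
apply Hk.
pose proof (cbrt_dev_le eta n m He Hn) as H.
assert (H' : Rabs (dev eta n m) / eta ^ 2 <= M / eta ^ 2).
{ apply Rmult_le_compat_r; [apply Rlt_le, Rinv_0_lt_compat; nra|exact HM]. }
apply (Rlt_div_l (INR k + 1 + M / eta ^ 2)) in HN; [|exact He].
assert (Hy : INR k + 1 <= cbrt m).
{ pose proof (Rle_abs (- (cbrt m - eta * cbrt n))) as H1; rewrite Rabs_Ropp in H1; lra. }
apply INR_le; rewrite <- (cbrt_pow3 m).
pose proof (pos_INR k).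
assert (1 <= cbrt m * cbrt m) by nra.
replace (cbrt m ^ 3) with (cbrt m * (cbrt m * cbrt m)) by ring; nra.
Qed.

(** The exponential of [side_eq] with [y - y0] replaced by [x / (3 eta^2)] and [2 y + y0] by
    [3 eta N], their leading values as [y / N] tends to [eta]. *)
Definition side_limit (d eta s x : R) : R :=
  exp (s / (3 * eta ^ 2) * x - d / (9 * eta ^ 3) * x ^ 2).

(** Since [x] does not converge, the limit is that of a quotient. Its exponent is
    [x * phi1 + x ^ 2 * phi2], where [phi1] and [phi2] are continuous in the ratio of the cube roots
    and vanish at [eta]; the power [n^b / m^b] is that ratio raised to [- 3 b]. *)
Lemma side_lim (d eta s b v M : R) (al : nat -> R) :
  0 < d -> 0 < eta -> is_lim_seq (fun m => al m / weight (d * eta) s b m) v ->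
  filterlim (fun p => side d eta s b al (fst p) (snd p)
                      / side_limit d eta s (dev eta (fst p) (snd p)))
    (window (dev eta) M) (locally (v * Rpower eta (- (3 * b)))).
Proof.
intros Hd He Hal.
set (u := fun p => cbrt (snd p) / cbrt (fst p)).
set (X := fun p : nat * nat => dev eta (fst p) (snd p)).
set (q := fun t => t ^ 2 + t * eta + eta ^ 2).
set (phi1 := fun t => s * (/ q t - / q eta)).
set (phi2 := fun t => - (d / 3) * ((2 * t + eta) / q t ^ 2 - (2 * eta + eta) / q eta ^ 2)).
assert (Hu := window_cbrt_ratio eta M He : filterlim u _ _).
apply filterlim_ext_loc with (fun p => al (snd p) / weight (d * eta) s b (snd p)
   * Rpower (u p) (- (3 * b)) * exp (X p * phi1 (u p) + X p ^ 2 * phi2 (u p))).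
{ assert (Hs : window (dev eta) M (fun p => (1 <= snd p)%nat))
    by exact (window_snd eta M He _ (eventually_ge 1)).
  generalize (filter_and _ _ Hs (window_eventually (dev eta) M _ (eventually_ge 1))).
  apply filter_imp; intros [n m] [Hm Hn]; simpl fst in *; simpl snd in *.
  rewrite side_eq by exact Hn.
  pose proof (cbrt_pos n Hn) as HN; pose proof (cbrt_pos m Hm) as Hy.
  assert (E : forall a t w, a * exp t / exp w = a * exp (t - w)).
  { intros a t w; unfold Rminus; rewrite exp_plus, exp_Ropp; unfold Rdiv; ring. }
  unfold side_limit; rewrite E.
  f_equal; [f_equal|f_equal].
  - rewrite npow_ratio; unfold Rpower; f_equal; unfold u; simpl fst; simpl snd.
    rewrite <- !cbrt_pow3, !ln_pow, ln_div by assumption.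
    simpl; ring.
  - assert (Hup : 0 < u (n, m)) by (apply Rdiv_lt_0_compat; assumption).
    assert (Hq : 0 < q (u (n, m))) by (unfold q; nra).
    replace (cbrt m - eta * cbrt n) with (X (n, m) / q (u (n, m)))
      by (symmetry; exact (cbrt_dev_eq eta n m He Hn)).
    replace (2 * cbrt m + eta * cbrt n) with (cbrt n * (2 * u (n, m) + eta))
      by (unfold u; simpl; field; lra).
    fold (X (n, m)); unfold phi1, phi2.
    replace (dev eta n m) with (X (n, m)) by reflexivity.
    replace (q eta) with (3 * eta ^ 2) by (unfold q; ring).
    field; lra. }
replace (v * Rpower eta (- (3 * b))) with (v * Rpower eta (- (3 * b)) * exp 0)
  by (rewrite exp_0; ring).
assert (HX : window (dev eta) M (fun p => Rabs (X p) <= M)) by apply window_bound.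
apply filterlim_Rmult; [apply window_filter|apply filterlim_Rmult; [apply window_filter| |]|].
- exact (filterlim_comp _ _ _ snd _ _ _ _ (window_snd eta M He) Hal).
- apply (filterlim_comp _ _ _ u (fun t => Rpower t (- (3 * b))) _ (locally eta)); [exact Hu|].
  change (continuous (fun t => Rpower t (- (3 * b))) eta).
  apply (ex_derive_continuous (V := R_NormedModule)); unfold Rpower; auto_derive; exact He.
- apply (filterlim_comp _ _ _ _ exp _ (locally 0)).
  2:{ change (continuous exp 0); apply (ex_derive_continuous (V := R_NormedModule)).
      auto_derive; exact I. }
  replace 0 with (plus 0 0) by (unfold plus; simpl; ring).
  eapply filterlim_comp_2; [| |apply (filterlim_plus (V := R_NormedModule))].
  + apply filterlim_bounded_mult_0 with M; [apply window_filter|exact HX|].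
    apply filterlim_comp with (locally eta); [exact Hu|].
    replace 0 with (phi1 eta) by (unfold phi1; ring).
    change (continuous phi1 eta).
    apply (ex_derive_continuous (V := R_NormedModule)); unfold phi1, q.
    auto_derive; nra.
  + apply filterlim_bounded_mult_0 with (M ^ 2); [apply window_filter| |].
    { revert HX; apply filter_imp; intros p Hp.
      rewrite Rabs_pos_eq by nra; rewrite <- (pow2_abs (X p)).
      apply pow_incr; split; [apply Rabs_pos|exact Hp]. }
    apply filterlim_comp with (locally eta); [exact Hu|].
    replace 0 with (phi2 eta) by (unfold phi2; ring).
    change (continuous phi2 eta).
    apply (ex_derive_continuous (V := R_NormedModule)); unfold phi2, q.
    auto_derive.
    assert (0 < eta * eta) by nra.
    repeat apply Rmult_integral_contrapositive_currified; nra.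
Qed.

(** * Gaussian majorants and primitives *)

(** The weight is squared because one factor [1 / (1 + x ^ 2)] must remain for the summation, while
    the other makes the part outside a large window small. *)
Lemma gauss_decay (c a : R) : 0 < a ->
  exists K, 0 <= K /\ forall x, exp (c * Rabs x - a * x ^ 2) <= K / (1 + x ^ 2) ^ 2.
Proof.
intros Ha.
exists (16 * exp ((c + 2) ^ 2 / (4 * a))); split.
{ pose proof (exp_pos ((c + 2) ^ 2 / (4 * a))); lra. }
intros x; assert (Hx : 0 < 1 + x ^ 2) by nra.
apply Rle_div_r; [apply pow_lt, Hx|].
rewrite <- (pow2_abs x) in *; pose proof (Rabs_pos x) as Ht; set (t := Rabs x) in *.
(* From [exp (t / 2) >= 1 + t / 2], squared. Two such factors raise [c] to [c + 2], and completing
   the square yields the constant. *)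
assert (H1 : 1 + t ^ 2 <= 4 * exp t).
{ pose proof (exp_ineq1_le (t / 2)) as H.
  replace t with (t / 2 + t / 2) at 2 by field; rewrite exp_plus.
  assert ((1 + t / 2) * (1 + t / 2) <= exp (t / 2) * exp (t / 2))
    by (apply Rmult_le_compat; lra).
  nra. }
assert (H2 : (1 + t ^ 2) ^ 2 <= 16 * (exp t * exp t)).
{ replace (16 * (exp t * exp t)) with ((4 * exp t) ^ 2) by ring.
  apply pow_incr; lra. }
pose proof (exp_pos (c * t - a * t ^ 2)) as He.
apply Rle_trans with (exp (c * t - a * t ^ 2) * (16 * (exp t * exp t))).
{ apply Rmult_le_compat_l; lra. }
replace (exp (c * t - a * t ^ 2) * (16 * (exp t * exp t))) with
  (16 * exp ((c + 2) * t - a * t ^ 2)).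
2:{ replace ((c + 2) * t - a * t ^ 2) with (c * t - a * t ^ 2 + (t + t)) by ring.
    rewrite !exp_plus; ring. }
apply Rmult_le_compat_l; [lra|apply exp_le].
apply (Rle_div_r _ _ (4 * a)); [lra|].
pose proof (pow2_ge_0 (c + 2 - 2 * a * t)); nra.
Qed.

(** Comes from [B x - A x^2 = B^2 / (4 A) - (sqrt A x - B / (2 sqrt A))^2]. *)
Definition gauss_prim (A B x : R) : R :=
  exp (B ^ 2 / (4 * A)) / sqrt A * gauss_int (sqrt A * x - B / (2 * sqrt A)).

Lemma is_derive_gauss_prim (A B x : R) : 0 < A ->
  is_derive (gauss_prim A B) x (exp (B * x - A * x ^ 2)).
Proof.
intros HA; pose proof (sqrt_lt_R0 A HA) as HsA.
evar_last.
- apply (is_derive_scal (fun x => gauss_int (sqrt A * x - B / (2 * sqrt A)))).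
  apply (is_derive_comp gauss_int (fun x => sqrt A * x - B / (2 * sqrt A))).
  + apply is_derive_gauss_int.
  + auto_derive; [exact I|reflexivity].
- unfold scal; simpl; unfold mult; simpl.
  assert (EA : A = sqrt A * sqrt A) by (symmetry; apply sqrt_sqrt; lra).
  set (q := sqrt A) in *; clearbody q; subst A.
  replace (B * x - q * q * (x * (x * 1))) with
    (B * (B * 1) / (4 * (q * q)) + - ((q * x - B / (2 * q)) *
       ((q * x - B / (2 * q)) * 1))).
  + rewrite exp_plus; field; lra.
  + field; lra.
Qed.

Lemma is_lim_gauss_prim_p (A B : R) : 0 < A ->
  is_lim (gauss_prim A B) p_infty (exp (B ^ 2 / (4 * A)) * sqrt PI / sqrt A / 2).
Proof.
intros HA; pose proof (sqrt_lt_R0 A HA) as HsA.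
replace (Finite (exp (B ^ 2 / (4 * A)) * sqrt PI / sqrt A / 2)) with
  (Rbar_mult (exp (B ^ 2 / (4 * A)) / sqrt A) (sqrt PI / 2))
  by (simpl; f_equal; field; lra).
apply is_lim_scal_l, (filterlim_comp _ _ _ _ gauss_int _ (Rbar_locally' p_infty));
  [|exact is_lim_gauss_int].
intros P [M HM]; exists ((M + B / (2 * sqrt A)) / sqrt A); intros x Hx; apply HM.
apply Rlt_div_l in Hx; [lra|exact HsA].
Qed.

(** The reflection [x -> - x] exchanges [B] and [- B], which reduces this to the limit at plus
    infinity. *)
Lemma is_lim_gauss_prim_m (A B : R) : 0 < A ->
  is_lim (gauss_prim A B) m_infty (- (exp (B ^ 2 / (4 * A)) * sqrt PI / sqrt A / 2)).
Proof.
intros HA; pose proof (sqrt_lt_R0 A HA) as HsA.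
apply is_lim_ext with (fun x => - gauss_prim A (- B) (- x)).
{ intros x; unfold gauss_prim.
  replace (sqrt A * - x - - B / (2 * sqrt A)) with (- (sqrt A * x - B / (2 * sqrt A)))
    by (field; lra).
  rewrite gauss_int_opp; replace ((- B) ^ 2) with (B ^ 2) by ring; ring. }
apply (is_lim_opp (fun x => gauss_prim A (- B) (- x)) m_infty
  (exp (B ^ 2 / (4 * A)) * sqrt PI / sqrt A / 2)).
replace (B ^ 2) with ((- B) ^ 2) by ring.
apply (filterlim_comp _ _ _ Ropp (gauss_prim A (- B)) _ (Rbar_locally' p_infty));
  [|exact (is_lim_gauss_prim_p A (- B) HA)].
intros P [M HM]; exists (- M); intros x Hx; apply HM; lra.
Qed.

(** * The product of the two factors and the limit of the normalized sum *)

Lemma dev_compl (e1 e2 : R) (n k : nat) : e1 ^ 3 + e2 ^ 3 = 1 -> (k <= n)%nat ->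
  dev e2 n (n - k) = - dev e1 n k.
Proof.
intros He Hk; unfold dev; rewrite minus_INR by exact Hk.
replace (e2 ^ 3) with (1 - e1 ^ 3) by lra.
unfold Rdiv; ring.
Qed.

Lemma window_compl (e1 e2 M : R) : e1 ^ 3 + e2 ^ 3 = 1 ->
  filterlim (fun p => (fst p, (fst p - snd p)%nat)) (window (dev e1) M) (window (dev e2) M).
Proof.
intros He P; unfold filtermap, window; apply filter_imp; intros n H k Hk Hx.
apply H; [simpl; lia|]; simpl fst; simpl snd.
rewrite (dev_compl e1 e2 n k He Hk), Rabs_Ropp; exact Hx.
Qed.

Lemma side_limit_mul (d e1 e2 s1 s2 x : R) : 0 < e1 -> 0 < e2 ->
  side_limit d e1 s1 x * side_limit d e2 s2 (- x) =
  exp ((s1 / (3 * e1 ^ 2) - s2 / (3 * e2 ^ 2)) * x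
       - (d / (9 * e1 ^ 3) + d / (9 * e2 ^ 3)) * x ^ 2).
Proof.
intros H1 H2; unfold side_limit; rewrite <- exp_plus; f_equal; field; lra.
Qed.

Lemma side_mul_lim (d e1 e2 s1 s2 b1 b2 v1 v2 M : R) (al be : nat -> R) :
  0 < d -> 0 < e1 -> 0 < e2 -> e1 ^ 3 + e2 ^ 3 = 1 ->
  is_lim_seq (fun m => al m / weight (d * e1) s1 b1 m) v1 ->
  is_lim_seq (fun m => be m / weight (d * e2) s2 b2 m) v2 ->
  filterlim (fun p => side d e1 s1 b1 al (fst p) (snd p)
      * side d e2 s2 b2 be (fst p) (fst p - snd p)
      / (side_limit d e1 s1 (dev e1 (fst p) (snd p))
         * side_limit d e2 s2 (- dev e1 (fst p) (snd p))))
    (window (dev e1) M)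
    (locally (v1 * Rpower e1 (- (3 * b1)) * (v2 * Rpower e2 (- (3 * b2))))).
Proof.
intros Hd He1 He2 He Hal Hbe.
eapply filterlim_ext_loc.
2:{ apply filterlim_Rmult; [apply window_filter| |].
    - apply side_lim; [exact Hd|exact He1|exact Hal].
    - eapply filterlim_comp; [apply (window_compl e1 e2 M He)|].
      apply side_lim; [exact Hd|exact He2|exact Hbe]. }
generalize (window_le (dev e1) M); apply filter_imp; intros [n k] Hk.
simpl fst in *; simpl snd in *.
rewrite (dev_compl e1 e2 n k He Hk).
field; split; apply Rgt_not_eq, exp_pos.
Qed.

Lemma side_mul_bound (d e1 e2 s1 s2 b1 b2 v1 v2 : R) (al be : nat -> R) :
  0 < d -> 0 < e1 -> 0 < e2 -> e1 ^ 3 + e2 ^ 3 = 1 ->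
  is_lim_seq (fun m => al m / weight (d * e1) s1 b1 m) v1 ->
  is_lim_seq (fun m => be m / weight (d * e2) s2 b2 m) v2 ->
  exists K, 0 <= K /\ forall n k, (1 <= n)%nat -> (k <= n)%nat ->
    Rabs (side d e1 s1 b1 al n k * side d e2 s2 b2 be n (n - k))
      <= K / (1 + dev e1 n k ^ 2) ^ 2.
Proof.
intros Hd He1 He2 He Hal Hbe.
assert (H1 : e1 <= 1).
{ apply cube_le; [lra|lra|]; pose proof (pow_lt e2 3 He2); lra. }
assert (H2 : e2 <= 1).
{ apply cube_le; [lra|lra|]; pose proof (pow_lt e1 3 He1); lra. }
destruct (side_bound d e1 s1 b1 v1 al Hd (conj He1 H1) Hal) as [C1 [c1 [HC1 HB1]]].
destruct (side_bound d e2 s2 b2 v2 be Hd (conj He2 H2) Hbe) as [C2 [c2 [HC2 HB2]]].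
destruct (gauss_decay (c1 + c2) (d * e1 / 27 + d * e2 / 27)) as [K [HK HG]].
{ assert (0 < d * e1) by nra; assert (0 < d * e2) by nra; lra. }
exists (C1 * C2 * K); split.
{ apply Rmult_le_pos; [apply Rmult_le_pos|]; assumption. }
intros n k Hn Hk.
specialize (HB1 n k Hn Hk); specialize (HB2 n (n - k)%nat Hn (Nat.le_sub_l n k)).
rewrite (dev_compl e1 e2 n k He Hk), Rabs_Ropp in HB2.
set (x := dev e1 n k) in *; specialize (HG x).
rewrite Rabs_mult.
eapply Rle_trans; [apply (Rmult_le_compat _ _ _ _ (Rabs_pos _) (Rabs_pos _) HB1 HB2)|].
unfold Rdiv; rewrite (Rmult_assoc _ K); fold (K / (1 + x ^ 2) ^ 2).
apply Rle_trans with (C1 * C2 *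
  exp ((c1 + c2) * Rabs x - (d * e1 / 27 + d * e2 / 27) * x ^ 2)).
{ right; replace ((c1 + c2) * Rabs x - (d * e1 / 27 + d * e2 / 27) * x ^ 2) with
    ((c1 * Rabs x - d * e1 / 27 * x ^ 2) + (c2 * Rabs x - d * e2 / 27 * (- x) ^ 2)) by field.
  rewrite (exp_plus (c1 * Rabs x - d * e1 / 27 * x ^ 2)); unfold Rdiv; ring. }
apply Rmult_le_compat_l; [apply Rmult_le_pos; assumption|exact HG].
Qed.

Lemma is_lim_seq_inv_cbrt_sqr : is_lim_seq (fun n => / cbrt n ^ 2) 0.
Proof.
apply is_lim_seq_ext_loc with (fun n => / cbrt n * / cbrt n).
{ exists 1%nat; intros n Hn; pose proof (cbrt_pos n Hn); field; lra. }
replace (Finite 0) with (Finite (0 * 0)) by (f_equal; ring).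
assert (H : is_lim_seq (fun n => / cbrt n) 0).
{ replace (Finite 0) with (Rbar_inv p_infty) by reflexivity.
  apply is_lim_seq_inv; [exact is_lim_seq_cbrt|discriminate]. }
apply is_lim_seq_mult'; exact H.
Qed.

(** The deviations run from [- e1^3 N] at [k = 0] to [e2^3 N] at [k = n] in steps of [N^(-2)], so in
    the limit the Riemann sum exhausts both tails of the Gaussian. *)
Lemma side_sum_lim (d e1 e2 s1 s2 b1 b2 v1 v2 A B : R) (al be : nat -> R) :
  0 < d -> 0 < e1 -> 0 < e2 -> e1 ^ 3 + e2 ^ 3 = 1 ->
  A = d / (9 * e1 ^ 3) + d / (9 * e2 ^ 3) ->
  B = s1 / (3 * e1 ^ 2) - s2 / (3 * e2 ^ 2) ->
  is_lim_seq (fun m => al m / weight (d * e1) s1 b1 m) v1 ->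
  is_lim_seq (fun m => be m / weight (d * e2) s2 b2 m) v2 ->
  is_lim_seq (fun n => / cbrt n ^ 2 * sum_f_R0 (fun k =>
      side d e1 s1 b1 al n k * side d e2 s2 b2 be n (n - k)) n)
    (v1 * Rpower e1 (- (3 * b1)) * (v2 * Rpower e2 (- (3 * b2)))
     * (exp (B ^ 2 / (4 * A)) * sqrt PI / sqrt A)).
Proof.
intros Hd He1 He2 He EA EB Hal Hbe.
pose proof (pow_lt e1 3 He1) as He13; pose proof (pow_lt e2 3 He2) as He23.
assert (HA : 0 < A).
{ rewrite EA; apply Rplus_lt_0_compat; apply Rdiv_lt_0_compat; lra. }
destruct (side_mul_bound d e1 e2 s1 s2 b1 b2 v1 v2 al be Hd He1 He2 He Hal Hbe)
  as [K1 [HK1 HQ]].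
pose proof (fun M => side_mul_lim d e1 e2 s1 s2 b1 b2 v1 v2 M al be Hd He1 He2 He Hal Hbe)
  as HL.
set (L := v1 * Rpower e1 (- (3 * b1)) * (v2 * Rpower e2 (- (3 * b2)))) in *.
destruct (gauss_decay (Rabs B) A HA) as [K2 [HK2 HG]].
assert (HG' : forall x, exp (B * x - A * x ^ 2) <= K2 / (1 + x ^ 2) ^ 2).
{ intros x; eapply Rle_trans; [apply exp_le|apply HG].
  pose proof (Rle_abs (B * x)) as H; rewrite Rabs_mult in H; lra. }
assert (HW : forall K x, 0 <= K -> K / (1 + x ^ 2) ^ 2 <= K / (1 + x ^ 2)).
{ intros K x HK; apply Rmult_le_compat_l; [exact HK|].
  apply Rinv_le_contravar; nra. }
set (J := exp (B ^ 2 / (4 * A)) * sqrt PI / sqrt A).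
replace (L * J) with (L * (J / 2) - L * (- (J / 2))) by field.
apply (is_lim_seq_riemann (fun x => L * gauss_prim A B x)
  (fun x => L * exp (B * x - A * x ^ 2))
  (fun x => L * (exp (B * x - A * x ^ 2) * (B - 2 * A * x)))
  (Rabs L * (K2 * (Rabs B + 2 * A))) (L * - (J / 2)) (L * (J / 2))
  (fun n k => side d e1 s1 b1 al n k * side d e2 s2 b2 be n (n - k))
  (fun n => - e1 ^ 3 * cbrt n)).
- intros t; apply is_derive_scal, is_derive_gauss_prim, HA.
- intros t; auto_derive; [exact I|].
  replace (B * t + - (A * (t * (t * 1)))) with (B * t - A * t ^ 2) by ring; ring.
- intros t; rewrite !Rabs_mult, (Rabs_pos_eq (exp _)) by apply Rlt_le, exp_pos.
  unfold Rdiv; rewrite (Rmult_assoc (Rabs L)); apply Rmult_le_compat_l; [apply Rabs_pos|].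
  assert (Ht : 0 < 1 + t ^ 2) by nra.
  replace (K2 * (Rabs B + 2 * A) * / (1 + t ^ 2)) with
    (K2 / (1 + t ^ 2) ^ 2 * ((Rabs B + 2 * A) * (1 + t ^ 2))) by (field; lra).
  apply Rmult_le_compat; [apply Rlt_le, exp_pos|apply Rabs_pos|apply HG'|].
  eapply Rle_trans; [apply Rabs_triang|].
  rewrite Rabs_Ropp, !Rabs_mult, (Rabs_pos_eq 2), (Rabs_pos_eq A) by lra.
  pose proof (Rabs_pos B); rewrite <- (pow2_abs t).
  assert (Rabs t <= 1 + Rabs t ^ 2) by nra.
  assert (0 <= Rabs B * Rabs t ^ 2) by (apply Rmult_le_pos; [lra|apply pow2_ge_0]).
  assert (A * Rabs t <= A * (1 + Rabs t ^ 2)) by (apply Rmult_le_compat_l; lra).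
  nra.
- apply (is_lim_scal_l (gauss_prim A B) L m_infty (- (J / 2))), is_lim_gauss_prim_m, HA.
- apply (is_lim_scal_l (gauss_prim A B) L p_infty (J / 2)), is_lim_gauss_prim_p, HA.
- exists 1%nat; intros n Hn; apply Rinv_0_lt_compat, pow_lt, cbrt_pos, Hn.
- exact is_lim_seq_inv_cbrt_sqr.
- apply is_lim_seq_spec; intros M.
  generalize (eventually_cbrt_gt (- M / e1 ^ 3)); apply filter_imp; intros n H.
  apply (Rlt_div_l (- M)) in H; lra.
- apply is_lim_seq_spec; intros M.
  generalize (filter_and _ _ (eventually_ge 1) (eventually_cbrt_gt (M / e2 ^ 3))).
  apply filter_imp; intros n [Hn H].
  pose proof (cbrt_pos n Hn) as HN.
  apply (Rlt_div_l M) in H; [|exact He23].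
  assert (0 < / cbrt n ^ 2) by apply Rinv_0_lt_compat, pow_lt, HN.
  rewrite <- cbrt_pow3; replace (e2 ^ 3) with (1 - e1 ^ 3) in H by lra.
  replace (cbrt n ^ 3 * / cbrt n ^ 2) with (cbrt n) by (field; lra); lra.
- intros eps Heps.
  assert (HX : forall n k, (1 <= n)%nat -> - e1 ^ 3 * cbrt n + INR k * / cbrt n ^ 2 = dev e1 n k).
  { intros n k Hn; pose proof (cbrt_pos n Hn) as HN.
    unfold dev; rewrite <- (cbrt_pow3 n); field; lra. }
  (* Outside this window the term and its limit are together at most [(K1 + |L| K2) / (1 + x^2)^2],
     and one factor [1 + x^2 >= |x| > M] absorbs the numerator. Inside it, the error is the Gaussian
     times the deviation of the quotient from [L]. *)
  set (M := (K1 + Rabs L * K2) / eps).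
  assert (Hdel : 0 < eps / (K2 + 1)) by (apply Rdiv_lt_0_compat; lra).
  generalize (filter_and _ _ (eventually_ge 1)
    (proj1 (filterlim_locally _ _) (HL M) (mkposreal _ Hdel))).
  apply filter_imp; intros n [Hn Hw] k Hk; rewrite HX by exact Hn.
  specialize (Hw k Hk); specialize (HQ n k Hn Hk); simpl fst in Hw; simpl snd in Hw.
  rewrite side_limit_mul, <- EA, <- EB in Hw by assumption.
  set (x := dev e1 n k) in *; set (q := side d e1 s1 b1 al n k * _) in *.
  assert (Hx : 0 < 1 + x ^ 2) by nra.
  pose proof (exp_pos (B * x - A * x ^ 2)) as HE.
  specialize (HG' x); set (G := exp (B * x - A * x ^ 2)) in *.
  destruct (Rle_or_lt (Rabs x) M) as [HxM|HxM].
  + specialize (Hw HxM); change (Rabs (q / G - L) < eps / (K2 + 1)) in Hw.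
    replace (q - L * G) with (G * (q / G - L)) by (field; lra).
    rewrite Rabs_mult, (Rabs_pos_eq G) by lra.
    apply Rle_trans with (K2 / (1 + x ^ 2) * (eps / (K2 + 1))).
    { apply Rmult_le_compat; [lra|apply Rabs_pos| |lra].
      pose proof (HW K2 x HK2); lra. }
    apply Rle_trans with (K2 / (K2 + 1) * (eps / (1 + x ^ 2))); [right; field; lra|].
    rewrite <- (Rmult_1_l (eps / _)) at 2.
    apply Rmult_le_compat_r; [apply Rlt_le, Rdiv_lt_0_compat; lra|].
    apply (Rle_div_l K2); lra.
  + apply Rle_trans with ((K1 + Rabs L * K2) / (1 + x ^ 2) ^ 2).
    { unfold Rminus; eapply Rle_trans; [apply Rabs_triang|].
      rewrite Rabs_Ropp, Rabs_mult, (Rabs_pos_eq G) by lra.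
      unfold Rdiv; rewrite Rmult_plus_distr_r, (Rmult_assoc (Rabs L) K2).
      apply Rplus_le_compat; [exact HQ|].
      apply Rmult_le_compat_l; [apply Rabs_pos|exact HG']. }
    apply (Rle_div_l (K1 + _)); [apply pow_lt, Hx|].
    replace (eps / (1 + x ^ 2) * (1 + x ^ 2) ^ 2) with (eps * (1 + x ^ 2)) by (field; lra).
    unfold M in HxM; apply (Rlt_div_l (K1 + _)) in HxM; [|exact Heps].
    rewrite <- (pow2_abs x); pose proof (Rabs_pos x).
    assert (Rabs x <= 1 + Rabs x ^ 2) by nra.
    nra.
Qed.

(** The tangent terms cancel here, and [d e1^3 N^2 + d e2^3 N^2] recombines to [d N^2]; the
    remaining factor does not depend on [k]. *)
Lemma side_mul_eq (d e1 e2 s1 s2 b1 b2 : R) (al be : nat -> R) (n k : nat) :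
  e1 ^ 3 + e2 ^ 3 = 1 -> (k <= n)%nat ->
  side d e1 s1 b1 al n k * side d e2 s2 b2 be n (n - k) =
  al k * be (n - k)%nat * (npow n b1 * npow n b2 *
    exp (- (d * cbrt n ^ 2 + (s1 * e1 + s2 * e2) * cbrt n))).
Proof.
intros He Hk; unfold side; rewrite (dev_compl e1 e2 n k He Hk).
replace (- (d * cbrt n ^ 2 + (s1 * e1 + s2 * e2) * cbrt n)) with
  (- (d * e1 * (e1 * cbrt n) ^ 2 + s1 * (e1 * cbrt n) + 2 / 3 * d * cbrt n * dev e1 n k)
   + - (d * e2 * (e2 * cbrt n) ^ 2 + s2 * (e2 * cbrt n) + 2 / 3 * d * cbrt n * - dev e1 n k)).
{ rewrite exp_plus; ring. }
replace (d * cbrt n ^ 2) with (d * (e1 ^ 3 + e2 ^ 3) * cbrt n ^ 2) by (rewrite He; ring).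
ring.
Qed.

(** * Coefficients of the product of the generating functions *)

(** The series converges at some nonzero point, whereas beyond the radius of convergence its terms
    would not tend to 0. *)
Lemma gen_fun_radius (g : R -> R) (a : nat -> R) :
  gen_fun g a -> Rbar_lt 0 (CV_radius a).
Proof.
intros [eps H]; pose proof (cond_pos eps) as He.
apply Rbar_lt_le_trans with (Finite (Rabs (eps / 2))).
{ simpl; rewrite Rabs_pos_eq; lra. }
apply Rbar_not_lt_le; intros Hr.
apply (CV_disk_outside a (eps / 2) Hr).
assert (Hb : is_pseries a (eps / 2) (g (eps / 2))).
{ apply H; change (Rabs (eps / 2 - 0) < eps); rewrite Rabs_pos_eq; lra. }
apply is_pseries_R in Hb.
apply (ex_series_lim_0 (fun n => a n * (eps / 2) ^ n)); exists (g (eps / 2)); exact Hb.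
Qed.

(** Inside both discs of convergence the Cauchy product represents [g], and a power series with
    positive radius is determined by its values near 0. *)
Lemma gen_fun_mult (g1 g2 g : R -> R) (al be a : nat -> R) (n : nat) :
  gen_fun g1 al -> gen_fun g2 be -> (forall x, g x = g1 x * g2 x) -> gen_fun g a ->
  a n = PS_mult al be n.
Proof.
intros H1 H2 Hg Ha.
pose proof (gen_fun_radius g1 al H1) as R1; pose proof (gen_fun_radius g2 be H2) as R2.
assert (Hloc : forall c, Rbar_lt 0 (CV_radius c) ->
  locally 0 (fun x => Rbar_lt (Rabs x) (CV_radius c))).
{ intros c Hc; destruct (CV_radius c) as [r| |] eqn:Er; simpl in Hc; [|apply filter_forall; intros; exact I|contradiction].
  exists (mkposreal r Hc); intros x Hx; change (Rabs (x - 0) < r) in Hx.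
  rewrite Rminus_0_r in Hx; exact Hx. }
assert (Hm : gen_fun g (PS_mult al be)).
{ generalize (filter_and _ _ (filter_and _ _ H1 H2)
    (filter_and _ _ (Hloc al R1) (Hloc be R2))).
  unfold gen_fun; apply filter_imp; intros x [[P1 P2] [Q1 Q2]].
  rewrite Hg; apply is_pseries_mult; assumption. }
apply PSeries_ext_recip.
- exact (gen_fun_radius g a Ha).
- exact (gen_fun_radius g _ Hm).
- generalize (filter_and _ _ Ha Hm); apply filter_imp; intros x [P1 P2].
  rewrite (is_pseries_unique _ _ _ P1), (is_pseries_unique _ _ _ P2); reflexivity.
Qed.

(** * Closed form of the constants and conclusion *)

Lemma seq_equiv_weight (r s b v : R) (al : nat -> R) : v <> 0 ->
  seq_equiv al (fun n =>
    v * (exp (s * npow n (1/3) + r * npow n (2/3)) / npow n b)) ->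
  is_lim_seq (fun m => al m / weight r s b m) v.
Proof.
intros Hv H.
apply is_lim_seq_ext_loc with (fun n => v *
  (al n / (v * (exp (s * npow n (1/3) + r * npow n (2/3)) / npow n b)))).
{ exists 1%nat; intros n Hn.
  rewrite <- cbrt_npow, <- cbrt_sqr_npow by exact Hn.
  fold (weight r s b n); pose proof (weight_pos r s b n); field; lra. }
replace (Finite v) with (Rbar_mult v 1) by (simpl; f_equal; ring).
apply is_lim_seq_scal_l, H.
Qed.

Lemma ratio_cube_sum (r1 r2 d : R) : 0 < d -> d ^ 3 = r1 ^ 3 + r2 ^ 3 ->
  (r1 / d) ^ 3 + (r2 / d) ^ 3 = 1.
Proof.
intros Hd E; unfold Rdiv; rewrite !Rpow_mult_distr, <- Rmult_plus_distr_r, <- E.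
field; lra.
Qed.

Lemma curvature_eq (r1 r2 d : R) : 0 < r1 -> 0 < r2 -> 0 < d ->
  d ^ 3 = r1 ^ 3 + r2 ^ 3 ->
  d / (9 * (r1 / d) ^ 3) + d / (9 * (r2 / d) ^ 3) = d ^ 7 / (9 * r1 ^ 3 * r2 ^ 3).
Proof.
intros H1 H2 Hd E.
replace (d ^ 7) with (d ^ 4 * d ^ 3) by ring; rewrite E; field; lra.
Qed.

(** The source of the factor 3, of the shifts [3/2] and, as [d] is the cube root of [r1^3 + r2^3],
    of the [7/6] in the final formula. *)
Lemma sqrt_curvature (r1 r2 d A : R) : 0 < r1 -> 0 < r2 -> 0 < d ->
  d ^ 3 = r1 ^ 3 + r2 ^ 3 ->
  A = d / (9 * (r1 / d) ^ 3) + d / (9 * (r2 / d) ^ 3) ->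
  sqrt A = Rpower d (7/2) / (3 * Rpower r1 (3/2) * Rpower r2 (3/2)).
Proof.
intros H1 H2 Hd E EA.
assert (Hs : forall x k, 0 < x -> Rpower x (INR k / 2) * Rpower x (INR k / 2) = x ^ k).
{ intros x k Hx; rewrite <- Rpower_plus, <- Rpower_pow by exact Hx; f_equal; field. }
assert (HA : A = d ^ 7 / (9 * r1 ^ 3 * r2 ^ 3)).
{ rewrite EA; apply curvature_eq; assumption. }
assert (P1 := exp_pos (3/2 * ln r1)); assert (P2 := exp_pos (3/2 * ln r2)).
fold (Rpower r1 (3/2)) in P1; fold (Rpower r2 (3/2)) in P2.
assert (HP : 0 < Rpower d (7/2) / (3 * Rpower r1 (3/2) * Rpower r2 (3/2))).
{ apply Rdiv_lt_0_compat; [apply exp_pos|nra]. }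
apply sqrt_lem_1; [|lra|].
- rewrite HA; apply Rlt_le, Rdiv_lt_0_compat; [apply pow_lt, Hd|].
  pose proof (pow_lt r1 3 H1); pose proof (pow_lt r2 3 H2); nra.
- rewrite HA, <- (Hs d 7%nat Hd), <- (Hs r1 3%nat H1), <- (Hs r2 3%nat H2).
  replace (INR 7) with 7 by (simpl; ring); replace (INR 3) with 3 by (simpl; ring).
  field; lra.
Qed.

Theorem theorem4 (r1 r2 v1 v2 s1 s2 b1 b2 : R)
    (hr1 : 0 < r1) (hr2 : 0 < r2) (hv1 : v1 <> 0) (hv2 : v2 <> 0)
    (alpha beta a : nat -> R) (g1 g2 g : R -> R)
    (hg1 : gen_fun g1 alpha)
    (halpha : seq_equiv alpha (fun n =>
       v1 * (exp (s1 * npow n (1/3) + r1 * npow n (2/3)) / npow n b1)))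
    (hg2 : gen_fun g2 beta)
    (hbeta : seq_equiv beta (fun n =>
       v2 * (exp (s2 * npow n (1/3) + r2 * npow n (2/3)) / npow n b2)))
    (hg : forall x, g x = g1 x * g2 x)
    (ha : gen_fun g a) :
  seq_equiv a (fun n =>
    3 * v1 * v2 * sqrt PI * Rpower (r1^3 + r2^3) (b1 + b2 - 7/6)
      / (Rpower r1 (3 * b1 - 3/2) * Rpower r2 (3 * b2 - 3/2)
         * npow n (b1 + b2 - 2/3))
    * exp ((r2^2 * s1 - r1^2 * s2)^2 / (4 * r1 * r2 * (r1^3 + r2^3))
           + (r1 * s1 + r2 * s2) / Rpower (r1^3 + r2^3) (1/3) * npow n (1/3)
           + Rpower (r1^3 + r2^3) (1/3) * npow n (2/3))).

Proof.
set (D := r1 ^ 3 + r2 ^ 3).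
assert (HD : 0 < D) by (pose proof (pow_lt r1 3 hr1); pose proof (pow_lt r2 3 hr2); unfold D; lra).
set (d := Rpower D (1/3)).
assert (Hd : 0 < d) by apply exp_pos.
assert (Ed : d ^ 3 = D).
{ rewrite <- Rpower_pow by exact Hd; unfold d; rewrite Rpower_mult.
  replace (1 / 3 * INR 3) with 1 by (simpl; field); apply Rpower_1, HD. }
set (e1 := r1 / d); set (e2 := r2 / d).
assert (He1 : 0 < e1) by (apply Rdiv_lt_0_compat; assumption).
assert (He2 : 0 < e2) by (apply Rdiv_lt_0_compat; assumption).
assert (He : e1 ^ 3 + e2 ^ 3 = 1) by (apply ratio_cube_sum; assumption).
set (A := d / (9 * e1 ^ 3) + d / (9 * e2 ^ 3)).
set (B := s1 / (3 * e1 ^ 2) - s2 / (3 * e2 ^ 2)).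
pose proof (seq_equiv_weight r1 s1 b1 v1 alpha hv1 halpha) as Hal.
pose proof (seq_equiv_weight r2 s2 b2 v2 beta hv2 hbeta) as Hbe.
replace r1 with (d * e1) in Hal by (unfold e1; field; lra).
replace r2 with (d * e2) in Hbe by (unfold e2; field; lra).
pose proof (side_sum_lim d e1 e2 s1 s2 b1 b2 v1 v2 A B alpha beta Hd He1 He2 He
  eq_refl eq_refl Hal Hbe) as HS.
set (Co := v1 * Rpower e1 (- (3 * b1)) * (v2 * Rpower e2 (- (3 * b2))) * _) in HS.
pose proof (sqrt_curvature r1 r2 d A hr1 hr2 Hd Ed eq_refl) as HsA.
assert (HB : B ^ 2 / (4 * A) = (r2 ^ 2 * s1 - r1 ^ 2 * s2) ^ 2 / (4 * r1 * r2 * D)).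
{ rewrite <- Ed.
  assert (HA : A = d ^ 7 / (9 * r1 ^ 3 * r2 ^ 3)).
  { apply curvature_eq; assumption. }
  rewrite HA; unfold B, e1, e2; field; lra. }
assert (HCo : Co = 3 * v1 * v2 * sqrt PI * Rpower D (b1 + b2 - 7/6)
   / (Rpower r1 (3 * b1 - 3/2) * Rpower r2 (3 * b2 - 3/2))
   * exp ((r2 ^ 2 * s1 - r1 ^ 2 * s2) ^ 2 / (4 * r1 * r2 * D))).
{ unfold Co; rewrite HB, HsA.
  set (E0 := exp (_ / _)).
  assert (Hln : ln d = ln D / 3).
  { unfold d, Rpower; rewrite ln_exp; field. }
  assert (Hdiv : forall r b, 0 < r ->
    Rpower (r / d) (- (3 * b)) = Rpower D b / Rpower r (3 * b)).
  { intros r b Hr; unfold Rpower, Rdiv at 2; rewrite ln_div, Hln by assumption.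
    rewrite <- exp_Ropp, <- exp_plus; f_equal; field. }
  unfold e1, e2; rewrite !Hdiv by assumption.
  assert (Hsub : forall x y z, Rpower x (y - z) = Rpower x y / Rpower x z).
  { intros x y z; unfold Rminus; rewrite Rpower_plus, Rpower_Ropp; reflexivity. }
  rewrite !Hsub, Rpower_plus.
  replace (Rpower d (7/2)) with (Rpower D (7/6)).
  2:{ unfold Rpower; rewrite Hln; f_equal; field. }
  field; repeat split; apply Rgt_not_eq, exp_pos. }
assert (HCo0 : Co <> 0).
{ rewrite HCo; repeat apply Rmult_integral_contrapositive_currified; try assumption;
    try apply Rgt_not_eq, exp_pos; [lra|apply Rgt_not_eq, sqrt_lt_R0, PI_RGT_0|].
  apply Rinv_neq_0_compat, Rmult_integral_contrapositive_currified;
    apply Rgt_not_eq, exp_pos. }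
unfold seq_equiv.
(* The normalized sum tends to [Co], which is nonzero because [v1] and [v2] are, so dividing by [Co]
   gives the limit 1. *)
replace (Finite 1) with (Rbar_mult (/ Co) Co) by (simpl; f_equal; field; exact HCo0).
apply is_lim_seq_ext_loc with (2 := is_lim_seq_scal_l _ _ _ HS).
exists 1%nat; intros n Hn.
pose proof (cbrt_pos n Hn) as HN.
rewrite (gen_fun_mult g1 g2 g alpha beta a n hg1 hg2 hg ha); unfold PS_mult.
rewrite (sum_eq _ (fun k => alpha k * beta (n - k)%nat * (npow n b1 * npow n b2 *
  exp (- (d * cbrt n ^ 2 + (s1 * e1 + s2 * e2) * cbrt n))))).
2:{ intros k Hk; apply side_mul_eq; assumption. }
rewrite <- scal_sum.
set (S := sum_f_R0 _ n).
rewrite <- cbrt_npow, <- cbrt_sqr_npow by exact Hn.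
(* The [2/3] is the inverse step [cbrt n ^ 2] of the Riemann sum. *)
replace (npow n (b1 + b2 - 2/3)) with (npow n b1 * npow n b2 / cbrt n ^ 2).
2:{ rewrite cbrt_sqr_npow by exact Hn; unfold npow, Rminus.
    rewrite !Rpower_plus, Rpower_Ropp; reflexivity. }
rewrite exp_Ropp.
replace ((r1 * s1 + r2 * s2) / d) with (s1 * e1 + s2 * e2)
  by (unfold e1, e2; field; lra).
set (E0 := (r2 ^ 2 * s1 - r1 ^ 2 * s2) ^ 2 / (4 * r1 * r2 * D)) in *.
replace (E0 + (s1 * e1 + s2 * e2) * cbrt n + d * cbrt n ^ 2) with
  (E0 + (d * cbrt n ^ 2 + (s1 * e1 + s2 * e2) * cbrt n)) by ring.
rewrite (exp_plus E0).
set (E1 := exp (d * cbrt n ^ 2 + _)).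
assert (HE1 : 0 < E1) by apply exp_pos.
pose proof (npow_pos n b1); pose proof (npow_pos n b2).
transitivity (S / (Co * (cbrt n ^ 2 * E1 / (npow n b1 * npow n b2)))).
{ field; repeat split; try lra; exact HCo0. }
f_equal; rewrite HCo; field.
repeat split; try lra; apply Rgt_not_eq, exp_pos.
Qed.
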